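(* Let $k:=\lfloor \epsilon N\rfloor$; for each $p\in[P]$ let $q_p$ be the $(k+1)$-th largest value (counted with multiplicity) amongst $\{-\mathbf{b}_p^\top\boldsymbol{\xi}_i\}_{i\in[N]}$, let $h_{i,p}:=\frac{-\mathbf{b}_p^\top\boldsymbol{\xi}_i-q_p}{\|\mathbf{b}_p\|_*}$ for $i\in[N]$, let $[N]_p:=\{i\in[N]:-\mathbf{b}_p^\top\boldsymbol{\xi}_i>q_p\}$, let $N_p:=|[N]_p|$, and enumerate $[N]_p=\{(1,p),(2,p),\dots,(N_p,p)\}$, where $(j,p)\in[N]$ denotes the $j$-th index in the enumeration, so that $$h_{(N_p,p),p}\geq\cdots\geq h_{(1,p),p}.$$ Let $M>0$ be a sufficiently large constant (see context). Then for any $p\in[P]$ and any set $J=\{j_1,\dots,j_m\}$ with $m\ge1$ and $N_p\geq j_1\geq\cdots\geq j_m\geq1$, the inequality $$\frac{-q_p+d_p-\mathbf{a}_p^\top\mathbf{x}}{\|\mathbf{b}_p\|_*}-t+\sum_{i\in[m]}r_{(j_i,p)}\ \geq\ \sum_{i\in[m]}\big(h_{(j_i,p),p}-h_{(j_{i+1},p),p}\big)\big(1-z_{(j_i,p)}\big),$$ where $h_{(j_{m+1},p),p}:=0$, is valid for (i.e. satisfied by every point $(\mathbf{z},\mathbf{r},t,\mathbf{x})$ of) the feasible set defined by \begin{align*} & \mathbf{z}\in\{0,1\}^N,\ t\ge0,\ \mathbf{r}\in\mathbb{R}^N,\ \mathbf{r}\ge\mathbf{0},\ \mathbf{x}\in\mathcal{X},\\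 & \epsilon\, t \geq \theta + \frac{1}{N}\sum_{i\in[N]} r_i,\\ & M(1-z_i)\geq t-r_i, \quad i\in[N],\\ & \sum_{i\in[N]} z_i\leq k,\\ & \frac{\mathbf{b}_{p'}^\top \boldsymbol{\xi}_i+d_{p'}-\mathbf{a}_{p'}^\top\mathbf{x}}{\|\mathbf{b}_{p'}\|_*}+\frac{-\mathbf{b}_{p'}^\top\boldsymbol{\xi}_i-q_{p'}}{\|\mathbf{b}_{p'}\|_*}\, z_i\geq t-r_i, \quad i\in[N]_{p'},\ p'\in[P],\\ & \frac{-q_{p'}+d_{p'}-\mathbf{a}_{p'}^\top\mathbf{x}}{\|\mathbf{b}_{p'}\|_*}\geq t,\quad p'\in[P]. \end{align*}
   Context: Notation: $[n]:=\{1,\dots,n\}$. Fix positive integers $K,L,N,P$, a compact set $\mathcal{X}\subset\mathbb{R}^L$, a norm $\|\cdot\|$ on $\mathbb{R}^K$ with dual norm $\|\cdot\|_*$, samples $\boldsymbol{\xi}_1,\dots,\boldsymbol{\xi}_N\in\mathbb{R}^K$, a risk tolerance $\epsilon\in(0,1)$ and a radius $\theta>0$. For $p\in[P]$ let $\mathbf{a}_p\in\mathbb{R}^L$, $\mathbf{b}_p\in\mathbb{R}^K\setminus\{\mathbf{0}\}$, $d_p\in\mathbb{R}$. ''$M$ sufficiently large'' means: $M>0$ and $M\ge |\mathbf{b}_p^\top\boldsymbol{\xi}_i+d_p-\mathbf{a}_p^\top\mathbf{x}|/\|\mathbf{b}_p\|_*$ for all $\mathbf{x}\in\mathcal{X}$,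 $i\in[N]$, $p\in[P]$. Since $J$ is a set with $m$ elements, the $j_i$ are pairwise distinct. *)

(* Defs.v *)
(* MathComp-Analysis, over an arbitrary R : realType. *)
From HB Require Import structures.
From mathcomp Require Import all_boot all_order all_algebra.
From mathcomp Require Import all_classical all_reals all_analysis.

Set Implicit Arguments.
Unset Strict Implicit.
Unset Printing Implicit Defensive.

Import Order.TTheory GRing.Theory Num.Theory.
Import numFieldNormedType.Exports.

Local Open Scope classical_set_scope.
Local Open Scope ring_scope.

Definition dot (R : realType) (n : nat) (u v : 'cV[R]_n) : R := (u^T *m v) 0 0.

(* An arbitrary norm on R^n, distinct in general from the sup norm [`|_|] that
   the library attaches to 'cV[R]_n.  Nonnegativity follows from the axioms. *)
Record is_norm (R : realType) (n : nat) (nrm : 'cV[R]_n -> R) : Prop := IsNorm {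
  is_norm_triangle : forall u v, nrm (u + v) <= nrm u + nrm v;
  is_norm_homog : forall (c : R) u, nrm (c *: u) = `|c| * nrm u;
  is_norm_definite : forall u, nrm u = 0 -> u = 0 }.

Definition dual_norm (R : realType) (n : nat) (nrm : 'cV[R]_n -> R)
    (u : 'cV[R]_n) : R :=
  sup [set dot u v | v in [set v | nrm v <= 1]].

(* The index starts at 0: [nth_largest v k] is the (k+1)-th largest of the n
   values of v counted with multiplicity.  The default 0 is only used if
   n <= k. *)
Definition nth_largest (R : realType) (n : nat) (v : 'I_n -> R) (k : nat) : R :=
  nth 0 (sort (fun x y : R => y <= x) [seq v i | i <- enum 'I_n]) k.

(* The successor of [f i] in the finite sequence f followed by a final 0. *)
Definition next_or0 (R : realType) (m : nat) (f : 'I_m -> R) (i : 'I_m) : R :=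
  if insub i.+1 is Some i' then f i' else 0.

Definition sufficiently_large (R : realType) (K L N P : nat)
    (X : set 'cV[R]_L) (nrm : 'cV[R]_K -> R) (xi : 'I_N -> 'cV[R]_K)
    (a : 'I_P -> 'cV[R]_L) (b : 'I_P -> 'cV[R]_K) (d : 'I_P -> R) (M : R)
    : Prop :=
  0 < M /\
  forall x, X x -> forall (i : 'I_N) (p : 'I_P),
    `|dot (b p) (xi i) + d p - dot (a p) x| / dual_norm nrm (b p) <= M.

Record feasible (R : realType) (K L N P : nat)
    (X : set 'cV[R]_L) (nrm : 'cV[R]_K -> R) (xi : 'I_N -> 'cV[R]_K)
    (eps theta : R)
    (a : 'I_P -> 'cV[R]_L) (b : 'I_P -> 'cV[R]_K) (d : 'I_P -> R)
    (M : R) (k : nat) (q : 'I_P -> R) (Np : 'I_P -> {set 'I_N})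
    (z r : 'cV[R]_N) (t : R) (x : 'cV[R]_L) : Prop := Feasible {
  feasible_binary : forall i, z i 0 = 0 \/ z i 0 = 1;
  feasible_t : 0 <= t;
  feasible_r : forall i, 0 <= r i 0;
  feasible_x : X x;
  feasible_radius : eps * t >= theta + N%:R^-1 * \sum_(i < N) r i 0;
  feasible_bigM : forall i, M * (1 - z i 0) >= t - r i 0;
  feasible_card : \sum_(i < N) z i 0 <= k%:R;
  feasible_strong : forall p i, i \in Np p ->
    (dot (b p) (xi i) + d p - dot (a p) x) / dual_norm nrm (b p)
    + (- dot (b p) (xi i) - q p) / dual_norm nrm (b p) * z i 0 >= t - r i 0;
  feasible_quantile : forall p,
    (- q p + d p - dot (a p) x) / dual_norm nrm (b p) >= t }.

(* Main.v *)
(* For each index i of [N]_p, the strengthened constraint says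
   h_i (1 - z_i) <= w + r_i with w := (- q_p + d_p - a_p^T x) / ||b_p||_* - t,
   and w >= 0.  These are the constraints of a mixing set.  If i is the first
   position of J with z_(j_i) = 0, the right-hand side of the inequality is at
   most the telescoping sum of the differences from i on, namely h_(j_i), hence
   at most w + r_(j_i). *)
Require Import Defs.
From HB Require Import structures.
From mathcomp Require Import all_boot all_order all_algebra.
From mathcomp Require Import all_classical all_reals all_analysis.
From mathcomp Require Import lra.

Import Order.TTheory GRing.Theory Num.Theory.
Import numFieldNormedType.Exports.

Local Open Scope classical_set_scope.
Local Open Scope ring_scope.

(** Induction on [n]: a head with [y = 0] contributes nothing and is dropped, a head with [y = 1]
    settles the bound at once. Indexing [v] by [nat] lets the shift [v \o succn] keep the same form,
    with the terminal value at [n]. *)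
Lemma mixing_sum_le (R : realDomainType) (n : nat) (w : R) (v : nat -> R)
    (y r : 'I_n -> R) :
  0 <= w -> 0 <= v n -> (forall i : 'I_n, v i.+1 <= v i) ->
  (forall i, y i = 0 \/ y i = 1) -> (forall i, 0 <= r i) ->
  (forall i : 'I_n, v i * y i <= w + r i) ->
  \sum_(i < n) (v i - v i.+1) * y i <= w + \sum_(i < n) r i.
Proof.
move=> w_ge0; elim: n v y r => [|n IHn] v y r vn_ge0 v_anti y01 r_ge0 vy_le.
  by rewrite !big_ord0 addr0.
case: (y01 ord0) => y0.
  rewrite [leLHS]big_ord_recl y0 mulr0 add0r big_ord_recl addrCA.
  rewrite -[leLHS]add0r lerD //.
  apply: (IHn (v \o succn)) => // i.
  - exact: (v_anti (lift ord0 i)).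
  - exact: (vy_le (lift ord0 i)).
have -> : \sum_i r i = r ord0 + \sum_(i < n) r (lift ord0 i).
  by rewrite big_ord_recl.
have := vy_le ord0; rewrite y0 mulr1 => v0_le.
rewrite addrA ler_wpDr ?sumr_ge0 //; apply: le_trans v0_le.
(* Raising every [y i] to 1 only increases the sum, which then telescopes to [v 0 - v n.+1]. *)
apply: (@le_trans _ _ (\sum_(0 <= i < n.+1) (v i - v i.+1))).
  rewrite big_mkord; apply: ler_sum => i _.
  rewrite -[leRHS]mulr1 ler_wpM2l ?subr_ge0 //.
  by case: (y01 i) => ->.
under eq_bigr do rewrite -opprB.
by rewrite sumrN telescope_sumr // opprB gerBl.
Qed.

Lemma dual_norm_ge0 (R : realType) (n : nat) (nrm : 'cV[R]_n -> R)
    (u : 'cV[R]_n) :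
  is_norm nrm -> 0 <= dual_norm nrm u.
Proof.
move=> nrmP; rewrite /dual_norm; set S := [set _ | _ in _].
have S0 : S 0.
  exists 0; last by rewrite /dot mulmx0 mxE.
  by rewrite /= -(scale0r 0) (is_norm_homog nrmP) normr0 mul0r.
(* If [S] has no supremum, [sup] takes its default value 0; otherwise it bounds the element 0. *)
have [supS|/sup_out -> //] := pselect (has_sup S).
exact: (ub_le_sup supS.2).
Qed.

Theorem proposition2 (R : realType) (K L N P : nat)
    (hK : (0 < K)%N) (hL : (0 < L)%N) (hN : (0 < N)%N) (hP : (0 < P)%N)
    (X : set 'cV[R]_L) (hX : compact X)
    (nrm : 'cV[R]_K -> R) (hnrm : is_norm nrm)
    (xi : 'I_N -> 'cV[R]_K)
    (eps : R) (heps : 0 < eps < 1) (theta : R) (htheta : 0 < theta)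
    (a : 'I_P -> 'cV[R]_L) (b : 'I_P -> 'cV[R]_K) (hb : forall p, b p != 0)
    (d : 'I_P -> R)
    (k : nat) (hk : k%:Z = Num.floor (eps * N%:R))
    (q : 'I_P -> R)
    (hq : forall p, q p = nth_largest (fun i => - dot (b p) (xi i)) k)
    (h : 'I_N -> 'I_P -> R)
    (hh : forall i p,
       h i p = (- dot (b p) (xi i) - q p) / dual_norm nrm (b p))
    (Np : 'I_P -> {set 'I_N})
    (hNp : forall p, Np p = [set i | q p < - dot (b p) (xi i)]%SET)
    (* [e p j] is the index written (j + 1, p) with 1-based counting *)
    (e : forall p, 'I_#|Np p| -> 'I_N)
    (he_inj : forall p, injective (e p))
    (he_im : forall p, [set e p j | j : 'I_#|Np p|]%SET = Np p)
    (he_mono : forall p (j j' : 'I_#|Np p|),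
       (j <= j')%N -> h (e p j) p <= h (e p j') p)
    (M : R) (hM : sufficiently_large X nrm xi a b d M) :
  forall (p : 'I_P) (m : nat) (j : 'I_m -> 'I_#|Np p|),
    (1 <= m)%N ->
    injective j ->
    (forall i i' : 'I_m, (i <= i')%N -> (j i' <= j i)%N) ->
  forall (z r : 'cV[R]_N) (t : R) (x : 'cV[R]_L),
    feasible X nrm xi eps theta a b d M k q Np z r t x ->
    (- q p + d p - dot (a p) x) / dual_norm nrm (b p) - t
      + \sum_(i < m) r (e p (j i)) 0
    >= \sum_(i < m) (h (e p (j i)) p - next_or0 (fun l => h (e p (j l)) p) i)
                    * (1 - z (e p (j i)) 0).
Proof.
move=> p m j _ _ j_anti z r t x [z01 _ r_ge0 _ _ _ _ strong quantile].
set c := dual_norm nrm (b p).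
have c_ge0 : 0 <= c^-1 by rewrite invr_ge0 dual_norm_ge0.
have eN l : e p l \in Np p by rewrite -he_im imset_f.
have h_ge0 l : 0 <= h (e p l) p.
  rewrite hh mulr_ge0 // subr_ge0 ltW //.
  by have := eN l; rewrite hNp inE.
pose f l := h (e p (j l)) p.
(* Extending [f] by 0 beyond [m] encodes the convention for the index [m+1]: [next_or0] at [i]
   becomes [v i.+1]. *)
pose v i := if insub i is Some i' then f i' else 0.
have vE (i : 'I_m) : v i = f i by rewrite /v valK.
under eq_bigr => i _ do rewrite -[h _ p]/(f i) -[next_or0 _ i]/(v i.+1) -vE.
apply: mixing_sum_le => [||i|i|i|i].
- by rewrite subr_ge0 quantile.
- by rewrite /v insubF ?ltnn.
(* At the last position the successor is the default 0, so monotonicity there is [h_ge0]. *)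
- rewrite vE /v; case: insubP => [i' _ i'E|_]; last exact: h_ge0.
  by apply/he_mono/j_anti; rewrite i'E.
- by case: (z01 (e p (j i))) => ->; rewrite ?subr0 ?subrr; [right|left].
- exact: r_ge0.
(* The first quotient in [strong] is [(- q p + d p - dot (a p) x) / c] minus [h], so moving
   [h * (1 - z)] across gives the mixing constraint. *)
- have := strong p _ (eN (j i)); rewrite vE /f hh -/c; lra.
Qed.
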